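(* Let $(X,\to,{}^*,1)$ be a quantum-Wajsberg algebra with $0=1^*$, and let $\mathcal{Z}(X)=\{x\in X\mid x\Cap y=y\Cap x\text{ for all }y\in X\}$. Then $(\mathcal{Z}(X),\Cap,\Cup,0,1)$ is a distributive sublattice of the poset $(X,\le_Q,0,1)$; that is, $\mathcal{Z}(X)$ contains $0,1$, is closed under $\Cap$ and $\Cup$, for all $x,y\in\mathcal{Z}(X)$ the elements $x\Cap y$ and $x\Cup y$ are respectively the greatest lower bound and the least upper bound of $\{x,y\}$ with respect to $\le_Q$, and the resulting bounded lattice is distributive.
   Context: A BE algebra is an algebra $(X,\to,1)$ of type $(2,0)$ such that for all $x,y,z\in X$: $x\to x=1$; $x\to 1=1$; $1\to x=x$; $x\to(y\to z)=y\to(x\to z)$. It is bounded if there is $0\in X$ with $0\to x=1$ for all $x$; then $x^*:=x\to 0$. A bounded BE algebra is involutive if $x^{**}=x$ for all $x$; it is written $(X,\to,{}^*,1)$, with $0=1^*$. In an involutive BE algebra put $x\Cup y=(x\to y)\to y$, $x\Cap y=((x^*\to y^* )\to y^* )^*$, and $x\le_Q y$ iff $x=x\Cap y$. A quantum-Wajsberg algebra is an involutive BE algebra $(X,\to,{}^*,1)$ satisfying, for all $x,y,z\in X$, $x\to((x\Cap y)\Cap(z\Cap x))=(x\to y)\Cap(x\to z)$. In a quantum-Wajsberg algebra $\le_Q$ is a partial order with least element $0$ and greatest element $1$. *)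

(* Defs.v *)
From Stdlib Require Import Setoid.
From Stdlib Require Export Ensembles Relations_1 Partial_Order Cpo.

Set Implicit Arguments.

(* [zero] is part of the data, with [x^* := x -> 0]; the identity [0 = 1^*] is
   [star_one] below. *)
Record involutiveBE : Type := InvolutiveBE {
  carrier :> Type;
  imp : carrier -> carrier -> carrier;
  one : carrier;
  zero : carrier;
  imp_self : forall x, imp x x = one;
  imp_one : forall x, imp x one = one;
  one_imp : forall x, imp one x = x;
  imp_exchange : forall x y z, imp x (imp y z) = imp y (imp x z);
  zero_imp : forall x, imp zero x = one;
  imp_zero_involutive : forall x, imp (imp x zero) zero = x
}.

Arguments imp {_} _ _.
Arguments one {_}.
Arguments zero {_}.

Declare Scope qw_scope.
Delimit Scope qw_scope with qw.
Open Scope qw_scope.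

Infix "~>" := imp (at level 55, right associativity) : qw_scope.

Definition star {X : involutiveBE} (x : X) : X := x ~> zero.

Notation "x ^*" := (star x) (at level 1, left associativity, format "x ^*") : qw_scope.

Definition cup {X : involutiveBE} (x y : X) : X := (x ~> y) ~> y.

Definition cap {X : involutiveBE} (x y : X) : X := ((x^* ~> y^*) ~> y^*)^*.

Infix "⋓" := cup (at level 50, left associativity) : qw_scope.
Infix "⋒" := cap (at level 40, left associativity) : qw_scope.

Definition leQ {X : involutiveBE} (x y : X) : Prop := x = x ⋒ y.

Infix "≤Q" := leQ (at level 70, no associativity) : qw_scope.

Record quantumWajsberg : Type := QuantumWajsberg {
  qw_base :> involutiveBE;
  qw_axiom : forall x y z : qw_base,
    x ~> ((x ⋒ y) ⋒ (z ⋒ x)) = (x ~> y) ⋒ (x ~> z)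
}.

Definition center (X : quantumWajsberg) : Ensemble X :=
  fun x => forall y : X, x ⋒ y = y ⋒ x.

Section InvolutiveBETheory.

Variable X : involutiveBE.
Implicit Types x y z u v : X.

Lemma star_one : (one : X)^* = zero.
Proof. apply one_imp. Qed.

Lemma star_zero : (zero : X)^* = one.
Proof. apply imp_self. Qed.

Lemma star_star x : x^*^* = x.
Proof. apply imp_zero_involutive. Qed.

Lemma imp_star x y : x ~> y^* = y ~> x^*.
Proof. apply imp_exchange. Qed.

Lemma imp_contra x y : x^* ~> y^* = y ~> x.
Proof. rewrite imp_star, star_star; reflexivity. Qed.

Definition odot x y : X := (x ~> y^*)^*.

Lemma odot_imp x y z : odot x y ~> z = x ~> y ~> z.
Proof.
unfold odot; rewrite <- (imp_contra z), star_star, imp_exchange, imp_contra.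
reflexivity.
Qed.

Lemma odotA x y z : odot (odot x y) z = odot x (odot y z).
Proof.
unfold odot at 1; rewrite odot_imp; unfold odot; rewrite star_star; reflexivity.
Qed.

Lemma capE x y : x ⋒ y = odot y (y ~> x).
Proof. unfold cap, odot; rewrite imp_contra, imp_star; reflexivity. Qed.

Lemma cap_imp x y : y ~> x = one -> x ⋒ y = y.
Proof. intro H; unfold cap; rewrite imp_contra, H, one_imp, star_star; reflexivity. Qed.

Lemma leQ_refl x : x ≤Q x.
Proof. symmetry; apply cap_imp, imp_self. Qed.

Lemma leQ_odot x y : x ≤Q y -> x = odot y (y ~> x).
Proof. intro H; rewrite <- capE; exact H. Qed.

Lemma leQ_imp x y : x ≤Q y -> x ~> y = one.
Proof.
intro H; rewrite (leQ_odot H) at 1.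
rewrite odot_imp, (imp_exchange X y), imp_self; apply imp_one.
Qed.

Lemma leQ_antisym x y : x ≤Q y -> y ≤Q x -> x = y.
Proof.
intros Hxy Hyx; rewrite Hyx; symmetry; apply cap_imp, leQ_imp, Hxy.
Qed.

Lemma zero_leQ x : zero ≤Q x.
Proof.
unfold leQ, cap; rewrite star_zero, one_imp, imp_self, star_one; reflexivity.
Qed.

Lemma leQ_one x : x ≤Q one.
Proof.
unfold leQ, cap; rewrite star_one.
change (x = x^*^*^*^*); rewrite !star_star; reflexivity.
Qed.

End InvolutiveBETheory.

Arguments odot {X} _ _.

Section QuantumWajsbergTheory.

Variable X : quantumWajsberg.
Implicit Types x y z t : X.

Lemma star_leQ_imp x y : x^* ≤Q x ~> y.
Proof.
assert (H := qw_axiom X x zero y).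
replace (x ⋒ zero) with (zero : X) in H
  by (symmetry; apply cap_imp, zero_imp).
rewrite <- (zero_leQ X (y ⋒ x) : zero = zero ⋒ (y ⋒ x)) in H.
exact H.
Qed.

Lemma leQ_star x y : x ≤Q y -> y^* ≤Q x^*.
Proof.
intro H; rewrite (leQ_odot H); unfold odot; rewrite star_star; apply star_leQ_imp.
Qed.

Lemma odot_leQ x y : odot x y ≤Q x.
Proof.
rewrite <- (star_star X x) at 2; unfold odot; apply leQ_star, star_leQ_imp.
Qed.

Lemma leQ_trans x y z : x ≤Q y -> y ≤Q z -> x ≤Q z.
Proof.
intros Hxy Hyz; rewrite (leQ_odot Hxy), (leQ_odot Hyz) at 1.
rewrite odotA; apply odot_leQ.
Qed.

Lemma leQ_order : Order X (@leQ X).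
Proof.
split.
- exact (@leQ_refl X).
- exact leQ_trans.
- exact (@leQ_antisym X).
Qed.

Definition qw_poset : PO X :=
  Definition_of_PO X (Full_set X) (@leQ X)
    (Inhabited_intro X (Full_set X) one (Full_intro X one)) leQ_order.

End QuantumWajsbergTheory.

(* Main.v *)
(* A pair commuting for [⋒] also commutes for [⋓]: if [m = x ⋒ y = y ⋒ x] then
   [x ⋓ y = (x ~> m) ~> (y ~> m) ~> m], which is symmetric by exchange; hence the
   center is closed under [*].  If [x] and [y] are central and [m = x ⋒ y], then
   [m = odot x (x ~> y)], so [m ~> z] depends on [z] only through [z ⋒ x], and
   likewise through [z ⋒ y]; hence [z ⋒ m = odot m (m ~> z)] is the infimum of
   [x, y, z], as is [m ⋒ z].  Finally the axiom makes [a ~> _] preserve meets of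
   central elements, so dually [odot a] preserves their joins, and distributivity
   follows from [x ⋒ t = odot (t ~> x) t] with [t = y ⋓ z]. *)

Require Import Defs.

Section Involutive.

Variable X : involutiveBE.
Implicit Types x y z : X.

Lemma odotC x y : odot x y = odot y x.
Proof. unfold odot; now rewrite imp_star. Qed.

Lemma star_cup x y : (x ⋓ y)^* = x^* ⋒ y^*.
Proof. unfold cap, cup; now rewrite !star_star. Qed.

Lemma star_cap x y : (x ⋒ y)^* = x^* ⋓ y^*.
Proof. unfold cap, cup; now rewrite !star_star. Qed.

End Involutive.

Section QuantumWajsberg.

Variable X : quantumWajsberg.
Implicit Types a x y z : X.

Lemma leQ_imp_r x y : y ≤Q x ~> y.
Proof.
rewrite <- (star_star X y) at 1; rewrite <- (imp_contra X y x).
apply star_leQ_imp.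
Qed.

(** Writing [x] as [odot (y ~> x) y] turns [x ~> z] into [(y ~> x) ~> y ~> z], which lies above its
    consequent. *)
Lemma imp_leQ_l x y z : x ≤Q y -> y ~> z ≤Q x ~> z.
Proof.
intro H; rewrite (leQ_odot H), odotC, odot_imp; apply leQ_imp_r.
Qed.

Lemma imp_leQ_r x y z : x ≤Q y -> z ~> x ≤Q z ~> y.
Proof.
intro H; rewrite <- (imp_contra X x z), <- (imp_contra X y z).
now apply imp_leQ_l, leQ_star.
Qed.

Lemma odot_leQ_l x y z : x ≤Q y -> odot x z ≤Q odot y z.
Proof. intro H; now apply leQ_star, imp_leQ_l. Qed.

Lemma cap_leQ_r x y : x ⋒ y ≤Q y.
Proof. rewrite capE; apply odot_leQ. Qed.

Lemma cap_leQ_mono x y z : x ≤Q y -> x ⋒ z ≤Q y ⋒ z.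
Proof.
intro H; rewrite !capE, (odotC X z), (odotC X z).
now apply odot_leQ_l, imp_leQ_r.
Qed.

(** By monotonicity in the left argument, [z = z ⋒ y ≤Q x ⋒ y]. For [x ⋒ y] to be the infimum, what
    remains is [x ⋒ y ≤Q x], which centrality of [x] supplies. *)
Lemma leQ_cap x y z : z ≤Q x -> z ≤Q y -> z ≤Q x ⋒ y.
Proof. intros Hx Hy; rewrite Hy; now apply cap_leQ_mono. Qed.

Lemma leQ_cupE x y : x ≤Q y -> y = y ⋓ x.
Proof.
intro H; apply leQ_star in H; unfold leQ in H.
rewrite <- star_cup in H.
now rewrite <- (star_star X y), H, star_star at 1.
Qed.

(** The left side unfolds to [(x ~> y) ⋓ x^*], and the join is absorbed because [x^* ≤Q x ~> y]. *)
Lemma imp_capr x y : x ~> y ⋒ x = x ~> y.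
Proof.
rewrite capE; unfold odot; rewrite imp_star, (imp_star X x (x ~> y)).
symmetry; apply leQ_cupE, star_leQ_imp.
Qed.

Lemma cup_comm_of_cap_comm x y : x ⋒ y = y ⋒ x -> x ⋓ y = y ⋓ x.
Proof.
enough (Hm : forall u v : X, u ⋒ v = v ⋒ u ->
  u ⋓ v = (u ~> v ⋒ u) ~> (v ~> v ⋒ u) ~> v ⋒ u).
{ intro H; rewrite (Hm x y H), (Hm y x (eq_sym H)), H.
  apply imp_exchange. }
intros u v H; unfold cup at 1.
assert (Hv : v ⋒ u ≤Q v) by (rewrite <- H; apply cap_leQ_r).
(* With [m = v ⋒ u], what remains is [v = (v ~> m) ~> m = v ⋓ m], which follows from [m ≤Q v]. *)
rewrite (imp_capr u v); f_equal; now apply leQ_cupE.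
Qed.

Lemma center_star x : In X (center X) x -> In X (center X) x^*.
Proof.
intros Hx y; rewrite <- (star_star X y), <- !star_cup; f_equal.
apply cup_comm_of_cap_comm, Hx.
Qed.

Lemma center_zero : In X (center X) zero.
Proof.
intro y; rewrite <- (zero_leQ X y : zero = zero ⋒ y).
symmetry; apply cap_imp, zero_imp.
Qed.

Lemma center_one : In X (center X) one.
Proof. rewrite <- star_zero; apply center_star, center_zero. Qed.

Lemma center_cap_leQ_l x y : In X (center X) x -> x ⋒ y ≤Q x.
Proof. intro Hx; rewrite (Hx y); apply cap_leQ_r. Qed.

Lemma center_cap_leQ_r x y : In X (center X) x -> y ⋒ x ≤Q y.
Proof. intro Hx; rewrite <- (Hx y); apply cap_leQ_r. Qed.

(** Each side is the infimum of [x], [y] and the arbitrary element [z]; centrality of [x] and [y]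
    gives the bounds by left factors. *)
Lemma center_capA x y z : In X (center X) x -> In X (center X) y ->
  (x ⋒ y) ⋒ z = (z ⋒ x) ⋒ y.
Proof.
intros Hx Hy; apply leQ_antisym; repeat apply leQ_cap.
- apply cap_leQ_r.
- eapply leQ_trans; [apply cap_leQ_mono, center_cap_leQ_l, Hx |].
  apply center_cap_leQ_l, Hx.
- eapply leQ_trans; [apply cap_leQ_mono, cap_leQ_r |].
  apply center_cap_leQ_l, Hy.
- eapply leQ_trans; [apply center_cap_leQ_r, Hy | apply cap_leQ_r].
- apply cap_leQ_r.
- eapply leQ_trans; [apply center_cap_leQ_r, Hy |].
  apply center_cap_leQ_r, Hx.
Qed.

(** Since [y ⋒ x = odot (x ~> y) x], residuation exposes [x ~> z ⋒ x], where [imp_capr] applies. *)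
Lemma cap_imp_capr x y z : y ⋒ x ~> z ⋒ x = y ⋒ x ~> z.
Proof. now rewrite capE, odotC, !odot_imp, imp_capr. Qed.

Lemma center_cap x y : In X (center X) x -> In X (center X) y ->
  In X (center X) (x ⋒ y).
Proof.
intros Hx Hy z.
assert (Hw : (z ⋒ x) ⋒ y ≤Q x ⋒ y) by now apply cap_leQ_mono, cap_leQ_r.
rewrite center_capA by assumption.
(* The right factor [y] of the antecedent is dropped from the consequent; after commuting to
   [y ⋒ x], so is [x]. *)
assert (Hm : x ⋒ y ~> (z ⋒ x) ⋒ y = x ⋒ y ~> z).
{ rewrite cap_imp_capr, (Hx y); apply cap_imp_capr. }
(* With [m = x ⋒ y] and [w = (z ⋒ x) ⋒ y]: [z ⋒ m = odot m (m ~> z) = odot m (m ~> w) = w ⋒ m =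
   w]. *)
rewrite (capE X z (x ⋒ y)), <- Hm, <- capE; exact Hw.
Qed.

Lemma center_cup x y : In X (center X) x -> In X (center X) y ->
  In X (center X) (x ⋓ y).
Proof.
intros Hx Hy; rewrite <- (star_star X (x ⋓ y)), star_cup.
apply center_star, center_cap; now apply center_star.
Qed.

Lemma imp_center_cap a x y : In X (center X) x -> In X (center X) y ->
  a ~> x ⋒ y = (a ~> x) ⋒ (a ~> y).
Proof.
intros Hx Hy.
(* [imp_capr] adds the factor [a] on the left, so that both consequents become the infimum of [a],
   [x] and [y]. *)
rewrite <- qw_axiom, <- imp_capr; f_equal.
rewrite center_capA by assumption.
apply leQ_antisym; apply leQ_cap.
- now apply center_cap_leQ_r.
- rewrite (Hy a); now apply cap_leQ_mono, center_cap_leQ_r.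
- apply leQ_cap.
  + eapply leQ_trans; apply cap_leQ_r.
  + eapply leQ_trans; [apply cap_leQ_mono, cap_leQ_r |].
    now apply center_cap_leQ_l.
- eapply leQ_trans; [apply cap_leQ_r |].
  now apply center_cap_leQ_l.
Qed.

Lemma odot_center_cup a x y : In X (center X) x -> In X (center X) y ->
  odot a (x ⋓ y) = odot a x ⋓ odot a y.
Proof.
intros Hx Hy; rewrite <- (star_star X (odot a x ⋓ odot a y)), star_cup.
unfold odot; rewrite !star_star, star_cup, imp_center_cap; trivial;
  now apply center_star.
Qed.

Lemma center_leQ_cup_l x y : In X (center X) x -> x ≤Q x ⋓ y.
Proof.
intro Hx; rewrite <- (star_star X (x ⋓ y)), <- (star_star X x) at 1.
apply leQ_star; rewrite star_cup; now apply center_cap_leQ_l, center_star.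
Qed.

Lemma leQ_cup_r x y : y ≤Q x ⋓ y.
Proof. apply leQ_imp_r. Qed.

Lemma cup_leQ x y z : x ≤Q z -> y ≤Q z -> x ⋓ y ≤Q z.
Proof.
intros Hx Hy; rewrite <- (star_star X z), <- (star_star X (x ⋓ y)), star_cup.
now apply leQ_star, leQ_cap; apply leQ_star.
Qed.

Lemma center_cap_cup_distr x y z :
  In X (center X) x -> In X (center X) y -> In X (center X) z ->
  x ⋒ (y ⋓ z) = (x ⋒ y) ⋓ (x ⋒ z).
Proof.
intros Hx Hy Hz.
(* [x ⋒ u = odot (u ~> x) u], and [u ~> x] grows as [u] shrinks below [y ⋓ z]. This bounds each part
   after [odot] is distributed over the join. *)
assert (Hcap : forall u, u ≤Q y ⋓ z -> odot (y ⋓ z ~> x) u ≤Q x ⋒ u).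
{ intros u Hu; rewrite capE, (odotC X u).
  now apply odot_leQ_l, imp_leQ_l. }
apply leQ_antisym.
- rewrite capE, odotC, odot_center_cup by assumption.
  apply cup_leQ; (eapply leQ_trans; [apply Hcap |]).
  + now apply center_leQ_cup_l.
  + now apply center_leQ_cup_l, center_cap.
  + apply leQ_cup_r.
  + apply leQ_cup_r.
- apply cup_leQ; apply leQ_cap.
  + now apply center_cap_leQ_l.
  + eapply leQ_trans; [apply cap_leQ_r | now apply center_leQ_cup_l].
  + now apply center_cap_leQ_l.
  + eapply leQ_trans; [apply cap_leQ_r | apply leQ_cup_r].
Qed.

(** Dual of the previous law: [star] preserves the center and exchanges [⋒] and [⋓]. *)
Lemma center_cup_cap_distr x y z :
  In X (center X) x -> In X (center X) y -> In X (center X) z ->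
  x ⋓ (y ⋒ z) = (x ⋓ y) ⋒ (x ⋓ z).
Proof.
intros Hx Hy Hz; rewrite <- (star_star X (x ⋓ y ⋒ z)).
rewrite star_cup, (star_cap X y z), (center_cap_cup_distr x^* y^* z^*)
  by now apply center_star.
now rewrite star_cup, !star_cap, !star_star.
Qed.

Lemma center_cap_Glb x y : In X (center X) x ->
  Glb X (qw_poset X) (Couple X x y) (x ⋒ y).
Proof.
intro Hx; repeat split.
- intros z []; [now apply center_cap_leQ_l | apply cap_leQ_r].
- intros z [_ Hz]; apply leQ_cap; apply Hz; constructor.
Qed.

Lemma center_cup_Lub x y : In X (center X) x ->
  Lub X (qw_poset X) (Couple X x y) (x ⋓ y).
Proof.
intro Hx; repeat split.
- intros z []; [now apply center_leQ_cup_l | apply leQ_cup_r].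
- intros z [_ Hz]; apply cup_leQ; apply Hz; constructor.
Qed.

End QuantumWajsberg.

Theorem theorem4p3 (X : quantumWajsberg) :
  (In X (center X) zero /\ In X (center X) one) /\
  (forall x y : X, In X (center X) x -> In X (center X) y ->
     In X (center X) (x ⋒ y) /\ In X (center X) (x ⋓ y)) /\
  (forall x y : X, In X (center X) x -> In X (center X) y ->
     Glb X (qw_poset X) (Couple X x y) (x ⋒ y) /\
     Lub X (qw_poset X) (Couple X x y) (x ⋓ y)) /\
  (forall x y z : X,
     In X (center X) x -> In X (center X) y -> In X (center X) z ->
     x ⋒ (y ⋓ z) = (x ⋒ y) ⋓ (x ⋒ z) /\
     x ⋓ (y ⋒ z) = (x ⋓ y) ⋒ (x ⋓ z)).
Proof.
split; [split; [apply center_zero | apply center_one] |].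
split; [intros x y Hx Hy; split; [now apply center_cap | now apply center_cup] |].
split; [intros x y Hx _; split; [now apply center_cap_Glb | now apply center_cup_Lub] |].
intros x y z Hx Hy Hz; split.
- now apply center_cap_cup_distr.
- now apply center_cup_cap_distr.
Qed.
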